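(* Let $0<|q|<1$, let $r\ge 0$ be an integer, and let $a_1,\dots,a_{r+1},b_1,\dots,b_r$ be complex numbers with $(b_j;q)_n\neq 0$ for all $j,n$. Then, as an identity of formal power series in $t$ and $s$ with coefficients in $\mathbb C[x,y]$, $$\sum_{n=0}^\infty\sum_{m=0}^\infty(-1)^{n+m}q^{\binom n2+\binom m2}\psi_{n+m}^{(\mathbf a,\mathbf b)}(x,y|q)\frac{t^n}{(q;q)_n}\frac{s^m}{(q;q)_m}=(yt,ys;q)_\infty\sum_{n=0}^\infty\frac{(a_1,\dots,a_{r+1};q)_n}{(q,b_1,\dots,b_r;q)_n}(xt)^n\;{}_2\Phi_1\!\left[\begin{matrix}q^{-n},\,q/(yt)\\ 0\end{matrix};q;ys\right].$$
   Context: Notation: $(a;q)_0=1$, $(a;q)_n=\prod_{k=0}^{n-1}(1-aq^k)$, $(a;q)_\infty=\prod_{k=0}^\infty(1-aq^k)$ (expanded as $(z;q)_\infty=\sum_k(-1)^kq^{\binom k2}z^k/(q;q)_k$ when regarded as a power series in $z$), $(c_1,\dots,c_m;q)_n=\prod_i (c_i;q)_n$ (also for $n=\infty$), and $\left[{n\atop k}\right]_q=\frac{(q;q)_n}{(q;q)_k(q;q)_{n-k}}$. Basic hypergeometric series: ${}_2\Phi_1\!\left[\begin{matrix}\alpha,\beta\\ \gamma\end{matrix};q;z\right]=\sum_{k\ge0}\frac{(\alpha,\beta;q)_k}{(\gamma;q)_k}\frac{z^k}{(q;q)_k}$, with $(0;q)_k=1$; with $\alpha=q^{-n}$ the sum runs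 over $0\le k\le n$. On the right-hand side, $(xt)^n(q/(yt);q)_k(ys)^k=x^nt^{n-k}s^k\prod_{i=0}^{k-1}(yt-q^{i+1})$ for $0\le k\le n$, a polynomial with no terms of total degree less than $n$ in $(t,s)$, so the right-hand side is a well-defined formal power series. With $\mathbf a=(a_1,\dots,a_{r+1})$, $\mathbf b=(b_1,\dots,b_r)$, $$\psi_n^{(\mathbf a,\mathbf b)}(x,y|q)=\sum_{k=0}^n\left[{n\atop k}\right]_q\frac{(a_1,\dots,a_{r+1};q)_k}{(b_1,\dots,b_r;q)_k}(-1)^kq^{\binom{k+1}2-nk}x^ky^{n-k}.$$ *)

(* Defs.v *)
(* MathComp. *)
From mathcomp Require Import all_boot all_order all_algebra.
From mathcomp Require Import reals complex.
From mathcomp Require Import mpoly.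

Set Implicit Arguments.
Unset Strict Implicit.
Unset Printing Implicit Defensive.

Import Order.TTheory GRing.Theory Num.Theory.
Local Open Scope ring_scope.
Local Open Scope complex_scope.

Definition qpoch (K : comNzRingType) (a q : K) (n : nat) : K :=
  \prod_(k < n) (1 - a * q ^+ k).

Definition qpochs (K : comNzRingType) (m : nat) (c : 'I_m -> K) (q : K)
    (n : nat) : K :=
  \prod_(i < m) qpoch (c i) q n.

Definition qbinom (K : fieldType) (q : K) (n k : nat) : K :=
  qpoch q q n / (qpoch q q k * qpoch q q (n - k)).

(* The sum of the terms of index 0 <= k <= n of the series 2Phi1.  When
   alpha = q^-n and q != 0 this is the whole series, because
   (q^-n; q)_k = 0 for k > n. *)
Definition phi21 (K : fieldType) (n : nat) (alpha beta gamma q z : K) : K :=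
  \sum_(k < n.+1)
    qpoch alpha q k * qpoch beta q k / qpoch gamma q k
      * (z ^+ k / qpoch q q k).

(* The exponent of q may be negative, so it is computed in int. *)
Definition psi (K : fieldType) (L : algType K) (r : nat)
    (a : 'I_r.+1 -> K) (b : 'I_r -> K) (q : K) (n : nat) (x y : L) : L :=
  \sum_(k < n.+1)
    (qbinom q n k * (qpochs a q k / qpochs b q k) * (-1) ^+ k
       * q ^ ('C(k.+1, 2)%:Z - (n * k)%N%:Z))
    *: (x ^+ k * y ^+ (n - k)).

(* Formal power series in t and s with coefficients in A:
   f i j is the coefficient of t^i s^j. *)
Definition fps2 (A : nzRingType) : Type := nat -> nat -> A.

Definition fps2_mul (A : nzRingType) (f g : fps2 A) : fps2 A :=
  fun i j => \sum_(k < i.+1) \sum_(l < j.+1) f k l * g (i - k)%N (j - l)%N.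

Notation Cxy R := {mpoly (R[i])[2]}.

(* C[x,y][s][t]: the outer variable is t, the inner one is s, so that P`_i`_j
   is the coefficient of t^i s^j. *)
Notation Cxyts R := {poly {poly Cxy R}}.

(* The field C(x,y,t,s), in which expressions such as q/(yt) live. *)
Notation ratfun R := {fraction Cxyts R}.

Section RationalFunctions.
Variable R : realType.

Definition varx : Cxy R := 'X_ord0.
Definition vary : Cxy R := 'X_ord_max.

Definition polyF (P : Cxyts R) : ratfun R := tofrac P.
Definition cF (c : R[i]) : ratfun R := polyF c%:MP%:P%:P.
Definition xF : ratfun R := polyF varx%:P%:P.
Definition yF : ratfun R := polyF vary%:P%:P.
Definition tF : ratfun R := polyF 'X.
Definition sF : ratfun R := polyF 'X%:P.

(* \sum_(n >= 0) u n = S as formal power series in t and s: every u n is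
   (the fraction of) a polynomial P n, and each coefficient of the partial sums
   is eventually constant, equal to the corresponding coefficient of S. *)
Definition fps2_sum (u : nat -> ratfun R) (S : fps2 (Cxy R)) : Prop :=
  exists2 P : nat -> Cxyts R,
    forall n, u n = polyF (P n) &
    forall i j, exists N, forall M, (N <= M)%N ->
      \sum_(n < M) (P n)`_i`_j = S i j.

(* (z; q)_oo as a formal power series, through its expansion
   \sum_k (-1)^k q^(k choose 2) z^k / (q; q)_k. *)
Definition qpoch_infty (q : R[i]) (z : ratfun R) (E : fps2 (Cxy R)) : Prop :=
  fps2_sum (fun k => cF ((-1) ^+ k * q ^+ 'C(k, 2) / qpoch q q k) * z ^+ k) E.

End RationalFunctions.

(* Main.v *)
Require Import Defs.
From mathcomp Require Import all_boot all_order all_algebra.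
From mathcomp Require Import reals complex ring zify.
From mathcomp Require Import mpoly.

(** Both sides are compared coefficient by coefficient: first in the power of
[x], which is the index [N] of the series on the right and the summation index
of [psi] on the left, then in [t] and [s].

Let e_n = (-1)^n q^C(n,2) / (q;q)_n be the coefficients of Euler's expansion of
(z;q)_oo, extended by 0 to negative [n]. With this extension the rule
e_(n-1) = - q^(1-n) (1 - q^n) e_n holds for every integer [n], so that no
boundary case has to be separated below; this is [eulerzB1]. It has two
consequences.

First, the factors prod_(i<k) (yt - q^(i+1)) that (xt)^N 2Phi1 contains on the
right combine with (yt;q)_oo: since
prod_(i<k) (yt - q^(i+1)) = (-1)^k q^C(k+1,2) (yt q^-k; q)_k, multiplying
(yt;q)_oo by them only rescales [t] by q^-k, up to a scalar. In coefficients
this is [conv_numer], obtained by adding one factor at a time.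

Second, after (q^-N;q)_k has been rewritten with a q-binomial coefficient
([qpoch_qVn]), the coefficient of t^n s^m in the product of both infinite
products with the N-th summand is, up to a factor x^N y^(n+m-N) and a scalar,
sum_k [N, k]_q q^(-kn) e_(n-N+k) e_(m-k). By the q-Pascal rule this sum F_N
satisfies F_(N+1)(n, m) = F_N(n-1, m) + q^-n F_N(n, m-1), and hence has the
closed form of [sum_qbinom_eulerz], a form of the q-Vandermonde sum. The closed
form is the x^N coefficient of the left-hand side ([psi_coef_match]).

The remaining part relates the rational functions of the statement, such as
q/(yt), to polynomials in [t] and [s]: the N-th summand is a polynomial without
terms of total degree less than [N] ([polyF_summand], [coef_summand0]), so the
infinite sum over [N] is finite in each coefficient. *)

Set Implicit Arguments.
Unset Strict Implicit.
Unset Printing Implicit Defensive.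

Import Order.TTheory GRing.Theory Num.Theory.
Local Open Scope ring_scope.
Local Open Scope complex_scope.

(** * q-Pochhammer symbols, q-binomials and Euler coefficients *)

Section QCalculus.
Variables (K : fieldType) (q : K).

Lemma qpochS (c : K) n : qpoch c q n.+1 = qpoch c q n * (1 - c * q ^+ n).
Proof. by rewrite /qpoch big_ord_recr. Qed.

Lemma qpoch0 (c : K) : qpoch c q 0 = 1.
Proof. by rewrite /qpoch big_ord0. Qed.

Lemma prod_onesubq_qpoch N d :
  \prod_(i < N) (1 - q ^ ((N + d)%N%:Z - i%:Z)) * qpoch q q d
  = qpoch q q (N + d).
Proof.
elim: N => [|N IHN]; first by rewrite big_ord0 mul1r.
rewrite big_ord_recl addSn qpochS -IHN -mulrA mulrC.
congr (_ * _); last by rewrite subr0 -exprnP -exprS.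
congr (_ * _).
by apply: eq_bigr => i _; congr (1 - q ^ _); rewrite /= /bump; lia.
Qed.

Hypothesis q_not_unity : forall n, q ^+ n.+1 != 1.

Lemma onesubq_neq0 n : 1 - q ^+ n.+1 != 0.
Proof. by rewrite subr_eq0 eq_sym. Qed.

Lemma qpoch_q_neq0 n : qpoch q q n != 0.
Proof. by apply/prodf_neq0 => k _; rewrite -exprS onesubq_neq0. Qed.

Lemma qbinom0 n : qbinom q n 0 = 1.
Proof. by rewrite /qbinom qpoch0 subn0 mul1r divff ?qpoch_q_neq0. Qed.

Lemma qbinomn n : qbinom q n n = 1.
Proof. by rewrite /qbinom subnn qpoch0 mulr1 divff ?qpoch_q_neq0. Qed.

Lemma qbinomS n k : (k < n)%N ->
  qbinom q n.+1 k.+1 = qbinom q n k + q ^+ k.+1 * qbinom q n k.+1.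
Proof.
move=> /subnK <-; set d := (n - k.+1)%N; rewrite /qbinom.
have -> : ((d + k.+1).+1 - k.+1 = d.+1)%N by lia.
have -> : (d + k.+1 - k = d.+1)%N by lia.
have -> : (d + k.+1 - k.+1 = d)%N by lia.
rewrite !qpochS -!exprS addnS -addSn -addnS exprD.
have := qpoch_q_neq0 d; have := qpoch_q_neq0 k.
have := onesubq_neq0 d; have := onesubq_neq0 k.
by rewrite !exprS => ? ? ? ?; field; do ?[apply/andP; split].
Qed.

(** Weighted form of the q-Pascal rule: it turns a recursion for sums against
q-binomials into an induction on [n], the two boundary terms being absorbed
once and for all. *)
Lemma sum_qbinomS n (f : nat -> K) :
  \sum_(k < n.+2) qbinom q n.+1 k * f k
  = \sum_(k < n.+1) qbinom q n k * (q ^+ k * f k + f k.+1).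
Proof.
under [RHS]eq_bigr do rewrite mulrDr.
rewrite big_split /= big_ord_recl [X in _ = X + _]big_ord_recl.
rewrite big_ord_recr [X in _ = _ + X]big_ord_recr /=.
rewrite !qbinom0 !qbinomn expr0 !mul1r -!addrA; congr (_ + _).
rewrite addrA; congr (_ + _); rewrite -big_split /=; apply: eq_bigr => i _.
by rewrite /bump /= qbinomS //; ring.
Qed.

Definition euler n : K := (-1) ^+ n * q ^+ 'C(n, 2) / qpoch q q n.

(** Extended by zero to negative indices, so that the recurrence [eulerzB1]
holds for all integers and shifted indices need no case analysis. *)
Definition eulerz (z : int) : K := if z is Posz n then euler n else 0.

Hypothesis q_neq0 : q != 0.

(** At z = 0 the factor 1 - q^z vanishes, which matches the convention that
the coefficient of index -1 is zero. *)
Lemma eulerzB1 (z : int) :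
  eulerz (z - 1) = - (q ^ (1 - z) * (1 - q ^ z)) * eulerz z.
Proof.
case: z => [[|n]|n].
- by rewrite expr0z subrr mulr0 oppr0 mul0r.
- have -> : n.+1%:Z - 1 = n by lia.
  have -> : 1 - n.+1%:Z = - n%:Z by lia.
  rewrite /= /euler binS bin1 exprD qpochS -!exprS exprS.
  rewrite -exprnN -exprnP.
  have := qpoch_q_neq0 n; have := onesubq_neq0 n.
  have := expf_neq0 n q_neq0.
  rewrite exprS => ? ? ?; field; by apply/and3P; split.
- have -> : Negz n - 1 = Negz n.+1 by lia.
  by rewrite mulr0.
Qed.

(** A form of the q-Vandermonde sum. The left-hand side F_N(n, m) satisfies
F_(N+1)(n, m) = F_N(n-1, m) + q^-n F_N(n, m-1) by the q-Pascal rule, and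
[eulerzB1] shows that the right-hand side satisfies the same recursion: the
two shifted terms add up to - q^(1-n-m) (1 - q^(n+m)) times the unshifted one. *)
Lemma sum_qbinom_eulerz N (n m : int) :
  \sum_(k < N.+1) qbinom q N k
     * (q ^ (- (k%:Z * n)) * (eulerz (n - N%:Z + k%:Z) * eulerz (m - k%:Z)))
  = (-1) ^+ N * q ^ ('C(N.+1, 2)%:Z - (n + m) * N%:Z)
    * (\prod_(i < N) (1 - q ^ (n + m - i%:Z))) * (eulerz n * eulerz m).
Proof.
elim: N n m => [|N IHN] n m.
  rewrite big_ord_recl !big_ord0 qbinom0 /= !mul0r mulr0 oppr0 !subr0 !addr0.
  by rewrite !expr0z !mul1r.
rewrite (sum_qbinomS N (fun k => q ^ (- (k%:Z * n)) *
  (eulerz (n - N.+1%:Z + k%:Z) * eulerz (m - k%:Z)))).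
have IH1 := IHN (n - 1) m; have IH2 := IHN n (m - 1).
have e1 : n - 1 + m = n + m - 1 by lia.
have e2 : n + (m - 1) = n + m - 1 by lia.
rewrite e1 eulerzB1 in IH1; rewrite e2 eulerzB1 in IH2.
(* the recursion F_(N+1)(n, m) = F_N(n-1, m) + q^-n F_N(n, m-1) *)
transitivity (\sum_(k < N.+1) qbinom q N k * (q ^ (- (k%:Z * (n - 1))) *
    (eulerz (n - 1 - N%:Z + k%:Z) * eulerz (m - k%:Z)))
  + q ^ (- n) * \sum_(k < N.+1) qbinom q N k * (q ^ (- (k%:Z * n)) *
    (eulerz (n - N%:Z + k%:Z) * eulerz (m - 1 - k%:Z)))).
  rewrite mulr_sumr -big_split /=; apply: eq_bigr => k _.
  have -> : n - N.+1%:Z + k%:Z = n - 1 - N%:Z + k%:Z by lia.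
  have -> : n - N.+1%:Z + k.+1%:Z = n - N%:Z + k%:Z by lia.
  have -> : m - k.+1%:Z = m - 1 - k%:Z by lia.
  have -> : - (k.+1%:Z * n) = - n + - (k%:Z * n) by lia.
  have -> : - (k%:Z * (n - 1)) = k%:Z + - (k%:Z * n) by lia.
  rewrite !expfzDr // -exprnP; ring.
rewrite IH1 IH2 big_ord_recl /=.
have -> : \prod_(i < N) (1 - q ^ (n + m - (bump 0 i)%:Z))
        = \prod_(i < N) (1 - q ^ (n + m - 1 - i%:Z)).
  by apply: eq_bigr => i _; congr (1 - q ^ _); rewrite /bump; lia.
have -> : ('C(N.+2, 2)%:Z - (n + m) * N.+1%:Z)
   = ('C(N.+1, 2)%:Z - (n + m - 1) * N%:Z) + (1 + (- n - m)).
  rewrite [X in X%:Z]binS bin1; lia.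
rewrite subr0 !(expfzDr, invr_expz) // -!invr_expz expr1z.
have := expfz_neq0 n q_neq0; have := expfz_neq0 m q_neq0.
move=> ? ?; rewrite exprS; field.
by apply/and3P; split=> //; apply: expfz_neq0.
Qed.

Lemma qpoch_qVn N k : (k <= N)%N ->
  qpoch (q ^- N) q k / qpoch q q k
  = qbinom q N k * ((-1) ^+ k * q ^ ('C(k, 2)%:Z - (N * k)%N%:Z)).
Proof.
elim: k => [|k IHk] leN.
  by rewrite !qpoch0 qbinom0 muln0 subrr expr0z divff ?oner_neq0 // !mulr1.
move: IHk; rewrite ltnW // => /(_ isT).
rewrite /qbinom; move: leN => /subnK <-; set d := (N - k.+1)%N.
have -> : (d + k.+1 - k = d.+1)%N by lia.
have -> : (d + k.+1 - k.+1 = d)%N by lia.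
set M := (d + k.+1)%N.
move=> IHk; rewrite qpochS [qpoch q q k.+1]qpochS invfM mulrACA IHk -!exprS.
rewrite qpochS -!exprS.
have -> : 'C(k.+1, 2)%:Z - (M * k.+1)%N%:Z
        = ('C(k, 2)%:Z - (M * k)%N%:Z) + (k%:Z - M%:Z).
  by rewrite binS bin1; lia.
rewrite !expfzDr // -!exprnP; set z := q ^ (- _).
rewrite -exprnN /M exprD.
have := qpoch_q_neq0 d; have := qpoch_q_neq0 k.
have := onesubq_neq0 d; have := onesubq_neq0 k.
have := expf_neq0 d q_neq0; have := expf_neq0 k q_neq0.
by rewrite !exprS => ? ? ? ? ? ?; field; do ?[apply/andP; split].
Qed.

(** The product over [i] in the closed form of [sum_qbinom_eulerz] is
(q;q)_(n+m) / (q;q)_(n+m-N): divided by (q;q)_N, it supplies the q-binomial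
coefficient of [psi]. Both sides are the coefficient of
x^N y^(n+m-N) t^n s^m. *)
Lemma psi_coef_match N n m (u v : K) : (N <= n + m)%N ->
  (-1) ^+ (n + m) * q ^+ ('C(n, 2) + 'C(m, 2)) / (qpoch q q n * qpoch q q m)
    * (qbinom q (n + m) N * (u / v) * (-1) ^+ N
       * q ^ ('C(N.+1, 2)%:Z - ((n + m) * N)%N%:Z))
  = u / (qpoch q q N * v) *
    ((-1) ^+ N * q ^ ('C(N.+1, 2)%:Z - ((n + m) * N)%N%:Z)
       * (\prod_(i < N) (1 - q ^ ((n + m)%N%:Z - i%:Z)))
       * (euler n * euler m)).
Proof.
move=> leN.
have := prod_onesubq_qpoch N (n + m - N); rewrite subnKC // => poch.
rewrite /qbinom -poch {poch}.
set Q := q ^ _; set P := \prod_(i < N) _.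
rewrite /euler !exprD !invfM.
have := qpoch_q_neq0 n; have := qpoch_q_neq0 m.
have := qpoch_q_neq0 N; have := qpoch_q_neq0 (n + m - N).
set a := qpoch q q n; set b := qpoch q q m; set c := qpoch q q N.
set e := qpoch q q (n + m - N) => e0 c0 b0 a0.
rewrite -[RHS]mulr1 -(mulfV e0); ring.
Qed.

End QCalculus.

(** * Multiplication by the infinite products *)

Section Convolution.
Variables (K : fieldType) (q : K) (d : nat).
Notation L := {mpoly K[d]}.
Variables x y : L.

(** The coefficient of t^z in (yt;q)_oo. *)
Definition eulery (z : int) : L := eulerz q z *: y ^+ absz z.

(** The coefficient of t^z in the product of (yt;q)_oo with [P], and zero for
negative [z], so that multiplying [P] by a power of t is a shift of [z]. *)
Definition conv (P : {poly L}) (z : int) : L :=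
  if z is Posz n then \sum_(k < n.+1) eulery k%:Z * P`_(n - k) else 0.

(** The absolute value is harmless: if the sum of the indices is negative, one
of them is negative and both sides vanish. *)
Lemma mul_eulery (z1 z2 : int) :
  eulery z1 * eulery z2 = (eulerz q z1 * eulerz q z2) *: y ^+ absz (z1 + z2).
Proof.
rewrite /eulery -scalerAl -scalerAr scalerA.
by case: z1 z2 => n1 [] n2; rewrite /= ?(mul0r, mulr0, scale0r) // -exprD.
Qed.

Lemma conv1 z : conv 1 z = eulery z.
Proof.
case: z => n /=; last by rewrite /eulery scale0r.
rewrite big_ord_recr /= subnn coef1 eqxx mulr1 big1 ?add0r // => i _.
by rewrite coef1 subn_eq0 leqNgt ltn_ord mulr0.
Qed.

Lemma convX P z : conv ('X * P) z = conv P (z - 1).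
Proof.
case: z => [[|n]|n].
- by rewrite /= big_ord_recl big_ord0 subnn coefXM mulr0 addr0.
- have -> : n.+1%:Z - 1 = n by lia.
  rewrite /= big_ord_recr /= subnn coefXM mulr0 addr0; apply: eq_bigr => k _.
  by rewrite coefXM subSn ?leq_ord.
- by have -> : Negz n - 1 = Negz n.+1 by lia.
Qed.

Lemma convXn a P z : conv ('X^a * P) z = conv P (z - a%:Z).
Proof.
elim: a z => [|a IHa] z; first by rewrite expr0 mul1r subr0.
by rewrite exprS -mulrA convX IHa; congr conv; lia.
Qed.

Lemma convCB u v P1 P2 z :
  conv (u%:P * P1 - v%:P * P2) z = u * conv P1 z - v * conv P2 z.
Proof.
case: z => n /=; last by rewrite !mulr0 subr0.
rewrite !mulr_sumr -sumrB; apply: eq_bigr => k _.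
by rewrite coefB !coefCM; ring.
Qed.

(** The extraction of a coefficient in s, as a convolution of (ys;q)_oo with
the monomial s^k. *)
Lemma conv_delta m k :
  \sum_(l < m.+1) eulery l%:Z * ((m - l)%N == k)%:R = eulery (m%:Z - k%:Z).
Proof.
have -> : eulery (m%:Z - k%:Z) = conv ('X^k * 1) m by rewrite convXn conv1.
by apply: eq_bigr => l _; rewrite mulr1 coefXn.
Qed.

(** The numerator (yt)^k (q/(yt);q)_k, as a polynomial in t. *)
Definition numer k : {poly L} :=
  \prod_(i < k) (y%:P * 'X - (q ^+ i.+1)%:MP%:P).

(** The N-th term of the series on the right, with [c] for its ratio of
q-Pochhammer symbols: in (xt)^N 2Phi1 the denominators (yt)^k of the inner sum
cancel against t^N and (ys)^k. The outer variable is t, the inner one s. *)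
Definition summand (c : K) N : {poly {poly L}} :=
  \sum_(k < N.+1)
    map_poly polyC (((c * (qpoch (q ^- N) q k / qpoch q q k))%:MP * x ^+ N)%:P
       * ('X^(N - k) * numer k)) * ('X^k)%:P.

Lemma coef_summand c N i j :
  (summand c N)`_i`_j
  = \sum_(k < N.+1) (c * (qpoch (q ^- N) q k / qpoch q q k)) *:
      (x ^+ N * ('X^(N - k) * numer k)`_i * (j == k)%:R).
Proof.
rewrite /summand !coef_sum; apply: eq_bigr => k _.
by rewrite coefMC coef_map coefCM /= coefCM coefXn mul_mpolyC -!scalerAl.
Qed.

Lemma coef_summand0 c N i j : (i + j < N)%N -> (summand c N)`_i`_j = 0.
Proof.
move=> ltN; rewrite coef_summand big1 // => k _.
case: eqP => [jk|_]; last by rewrite mulr0 scaler0.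
by rewrite coefXnM ifT ?mulr0 ?mul0r ?scaler0 //; lia.
Qed.

Hypothesis q_not_unity : forall n, q ^+ n.+1 != 1.
Hypothesis q_neq0 : q != 0.

Lemma euleryB1 (z : int) :
  y * eulery (z - 1) = - (q ^ (1 - z) * (1 - q ^ z)) *: eulery z.
Proof.
rewrite /eulery eulerzB1 // -scalerAr scalerA -exprS.
case: z => [[|n]|n] /=.
- by rewrite expr0z subrr mulr0 oppr0 mul0r !scale0r.
- by congr (_ *: y ^+ _); lia.
- by rewrite mulr0 !scale0r.
Qed.

(** The factors of [numer k] are those of (yt q^-k; q)_k up to the scalar
(-1)^k q^C(k+1,2), and they complete (yt;q)_oo to (yt q^-k; q)_oo, whose
coefficients are those of (yt;q)_oo rescaled by powers of q^-k. *)
Lemma conv_numer k z :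
  conv (numer k) z
  = ((-1) ^+ k * q ^ ('C(k.+1, 2)%:Z - k%:Z * z)) *: eulery z.
Proof.
elim: k z => [|k IHk] z.
  by rewrite /numer big_ord0 conv1 mul0r subrr expr0z mulr1 scale1r.
rewrite /numer big_ord_recr -/(numer k) /= mulrC mulrBl -mulrA convCB convX.
rewrite !IHk mul_mpolyC -scalerAr euleryB1; move: (eulery z) => w.
rewrite !scalerA -scalerBl; congr (_ *: _).
have -> : 'C(k.+1, 2)%:Z - k%:Z * (z - 1)
        = k%:Z + ('C(k.+1, 2)%:Z - k%:Z * z) by lia.
rewrite [q ^ (k%:Z + _)]expfzDr // -exprnP; set Q := q ^ (_ - k%:Z * z).
have -> : 'C(k.+2, 2)%:Z - k.+1%:Z * z
        = ('C(k.+1, 2)%:Z - k%:Z * z) + (1 + k%:Z - z).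
  by rewrite binS bin1; lia.
rewrite expfzDr // -/Q !expfzDr // -exprnP -invr_expz expr1z !exprS.
have := expfz_neq0 z q_neq0 => ?; by field.
Qed.

(** By [conv_numer], the coefficient of t^n s^m in the product of (yt;q)_oo,
(ys;q)_oo and the N-th summand is a scalar sum of products of two Euler
coefficients, all with the same power of y; [sum_qbinom_eulerz] evaluates it.
For n + m < N the product over [i] vanishes, so the absolute value in
the exponent of y does no harm. *)
Lemma mul_euler_summand c N n m :
  \sum_(k < n.+1) \sum_(l < m.+1)
     eulery k%:Z * eulery l%:Z * (summand c N)`_(n - k)`_(m - l)
  = (c * ((-1) ^+ N * q ^ ('C(N.+1, 2)%:Z - ((n + m) * N)%N%:Z)
      * (\prod_(i < N) (1 - q ^ ((n + m)%N%:Z - i%:Z)))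
      * (euler q n * euler q m)))
    *: (x ^+ N * y ^+ absz ((n + m)%N%:Z - N%:Z)).
Proof.
transitivity (\sum_(j < N.+1) (c * (qpoch (q ^- N) q j / qpoch q q j)) *:
   (x ^+ N * (conv ('X^(N - j) * numer j) n * eulery (m%:Z - j%:Z)))).
  under eq_bigr do under eq_bigr do rewrite coef_summand mulr_sumr.
  under eq_bigr do rewrite exchange_big /=.
  rewrite exchange_big /=; apply: eq_bigr => j _.
  rewrite -conv_delta /conv mulr_suml mulr_sumr scaler_sumr.
  apply: eq_bigr => k _; rewrite !mulr_sumr scaler_sumr.
  by apply: eq_bigr => l _; rewrite -scalerAr; congr (_ *: _); ring.
have := sum_qbinom_eulerz q_not_unity q_neq0 N n m.
rewrite -!PoszD -PoszM => <-.
rewrite mulr_sumr scaler_suml; apply: eq_bigr => j0 _.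
move: (nat_of_ord j0) (ltn_ord j0) => j ltj.
rewrite convXn conv_numer -scalerAl mul_eulery scalerA.
have -> : n%:Z - (N - j)%N%:Z = n%:Z - N%:Z + j%:Z by lia.
have -> : n%:Z - N%:Z + j%:Z + (m%:Z - j%:Z) = (n + m)%N%:Z - N%:Z by lia.
rewrite -scalerAr scalerA; congr (_ *: _).
rewrite qpoch_qVn //.
suff -> : q ^ (- (j%:Z * n%:Z)) = q ^ ('C(j, 2)%:Z - (N * j)%N%:Z)
   * q ^ ('C(j.+1, 2)%:Z - j%:Z * (n%:Z - N%:Z + j%:Z)).
  set u := q ^ _; set v := q ^ _.
  (* the signs of [conv_numer] and [qpoch_qVn] cancel *)
  transitivity (((-1) ^+ j * (-1) ^+ j) * (c * (qbinom q N j * (u * v *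
    (eulerz q (n%:Z - N%:Z + j%:Z) * eulerz q (m%:Z - j%:Z)))))); first by ring.
  by rewrite -expr2 sqrr_sign mul1r.
rewrite -expfzDr //; congr (q ^ _).
(* the exponents agree because C(j,2) + C(j+1,2) = j^2 *)
have : ('C(j, 2) + 'C(j.+1, 2) = j * j)%N.
  elim: j {ltj} => // j IHj.
  by rewrite [in RHS]mulSn mulnS -IHj !binS !bin1 !bin0; lia.
by move: 'C(j, 2) 'C(j.+1, 2); lia.
Qed.

End Convolution.

(** * Clearing denominators in the hypergeometric series *)

Lemma qpoch_div_prod (F : fieldType) (p w : F) k : w != 0 ->
  w ^+ k * qpoch (p / w) p k = \prod_(i < k) (w - p ^+ i.+1).
Proof.
move=> w0; rewrite /qpoch -[X in w ^+ X](card_ord k) -prodr_const -big_split /=.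
by apply: eq_bigr => i _; rewrite exprS; field.
Qed.

Lemma qpoch_morph (K F : fieldType) (f : {rmorphism K -> F}) c q k :
  qpoch (f c) (f q) k = f (qpoch c q k).
Proof.
rewrite /qpoch rmorph_prod; apply: eq_bigr => i _.
by rewrite rmorphB rmorph1 rmorphM rmorphXn.
Qed.

(** Each of the [k] factors of (q/(YT);q)_k takes one factor YT from
(XT)^n (YS)^k, which leaves T^(n-k). *)
Lemma phi21_prod (K F : fieldType) (f : {rmorphism K -> F}) (q : K) n
    (X Y T S : F) : Y * T != 0 ->
  (X * T) ^+ n * phi21 n (f q ^- n) (f q / (Y * T)) 0 (f q) (Y * S)
  = \sum_(k < n.+1) f (qpoch (q ^- n) q k / qpoch q q k) *
      (X ^+ n * (T ^+ (n - k) * \prod_(i < k) (Y * T - f q ^+ i.+1)) * S ^+ k).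
Proof.
move=> YT0; rewrite /phi21 mulr_sumr; apply: eq_bigr => k0 _.
move: (nat_of_ord k0) (ltn_ord k0) => k lek.
have -> : qpoch 0 (f q) k = 1 by apply: big1 => i _; rewrite mul0r subr0.
rewrite -rmorphXn -fmorphV !qpoch_morph -qpoch_div_prod //.
rewrite rmorphM fmorphV divr1 !exprMn.
have -> : T ^+ n = T ^+ (n - k) * T ^+ k by rewrite -exprD subnK.
by ring.
Qed.

(** The field of fractions enters only through a ring morphism [phi] to a
field. Keeping both abstract avoids computing in the construction of
fractions. *)
Section Evaluation.
Variables (K : fieldType) (d : nat) (F : fieldType).
Notation L := {mpoly K[d]}.
Variable phi : {rmorphism {poly {poly L}} -> F}.
Variables (x y : L) (q : K).

Let cst (c : K) : F := phi c%:MP%:P%:P.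
Let coord (z : L) : F := phi z%:P%:P.
Let t : F := phi 'X.
Let s : F := phi 'X%:P.

Lemma morph_euler_t k :
  cst ((-1) ^+ k * q ^+ 'C(k, 2) / qpoch q q k) * (coord y * t) ^+ k
  = phi ((eulery q y k%:Z)%:P%:P * 'X^k).
Proof.
rewrite -/(euler q k) /eulery -mul_mpolyC exprMn mulrA /=.
by rewrite /cst /coord /t !(rmorphM, rmorphXn).
Qed.

Lemma morph_euler_s k :
  cst ((-1) ^+ k * q ^+ 'C(k, 2) / qpoch q q k) * (coord y * s) ^+ k
  = phi ((eulery q y k%:Z)%:P * 'X^k)%:P.
Proof.
rewrite -/(euler q k) /eulery -mul_mpolyC exprMn mulrA /=.
by rewrite /cst /coord /s !(rmorphM, rmorphXn).
Qed.

Lemma morph_summand c n : coord y * t != 0 ->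
  cst c * (coord x * t) ^+ n
    * phi21 n (cst q ^- n) (cst q / (coord y * t)) 0 (cst q) (coord y * s)
  = phi (summand q x y c n).
Proof.
move=> yt0; rewrite -mulrA.
rewrite (phi21_prod (phi \o polyC \o polyC \o @mpolyC d K)) //=.
rewrite mulr_sumr /summand rmorph_sum; apply: eq_bigr => k _.
have -> : \prod_(i < k) (coord y * t - cst q ^+ i.+1)
        = phi (map_poly polyC (numer q y k)).
  rewrite /numer !rmorph_prod; apply: eq_bigr => i _.
  by rewrite rmorphB rmorphM /= !map_polyC map_polyX /= rmorphXn /=
     !polyC_exp rmorphB rmorphM rmorphXn.
rewrite !(rmorphM, rmorphXn) /= !map_polyC map_polyX /=.
have reassoc (C A B X T U S : F) :
  C * (A * B * (X * (T * U) * S)) = C * (A * B) * X * (T * U) * S by ring.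
exact: reassoc.
Qed.

End Evaluation.

(** * Formal power series in the field of fractions *)

Lemma fps2_mul_prod (A : nzRingType) (f g : nat -> A) i j :
  fps2_mul (fun k l => f k * (l == 0)%:R) (fun k l => g l * (k == 0)%:R) i j
  = f i * g j.
Proof.
rewrite /fps2_mul big_ord_recr /= big1 ?add0r => [|k _]; last first.
  apply: big1 => l _; rewrite (_ : (i - k == 0)%N = false) ?mulr0 //.
  by rewrite subn_eq0 leqNgt ltn_ord.
rewrite big_ord_recl subnn !eqxx !mulr1 subn0 /= big1 ?addr0 // => l _.
by rewrite mulr0 mul0r.
Qed.

(** The canonical map to the fractions of C[x,y][s][t], with the ring
structure of each polynomial layer reached over abstract coefficients: the
structures obtained from an integral domain and from a ring then have to be
identified for one layer only. *)
Definition tofrac_morph (A : idomainType) : {rmorphism A -> {fraction A}} :=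
  @tofrac A.

Definition tofrac_poly (A : idomainType) :
    {rmorphism {poly A} -> {fraction {poly A}}} :=
  tofrac_morph {poly A}.

Definition tofrac_poly2 (A : idomainType) :
    {rmorphism {poly {poly A}} -> {fraction {poly {poly A}}}} :=
  tofrac_poly {poly A}.

Definition tofrac_mpoly (K : fieldType) d :
    {rmorphism {poly {poly {mpoly K[d]}}}
     -> {fraction {poly {poly {mpoly K[d]}}}}} :=
  tofrac_poly2 {mpoly K[d]}.

Definition polyF_morph (R : realType) : {rmorphism Cxyts R -> ratfun R} :=
  tofrac_mpoly R[i] 2.

Lemma tofrac_polyCX_neq0 (A : idomainType) (y : A) : y != 0 ->
  tofrac_poly2 A y%:P%:P * tofrac_poly2 A 'X != 0.
Proof.
by move=> y0; rewrite mulf_neq0 // tofrac_eq0 ?polyX_eq0 ?polyC_eq0.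
Qed.

Section Fractions.
Variable R : realType.
Implicit Types (P : Cxyts R) (c q : R[i]).

Lemma fps2_sum_order (u : nat -> ratfun R) (P : nat -> Cxyts R) :
  (forall n, u n = polyF (P n)) ->
  (forall n i j, (i + j < n)%N -> (P n)`_i`_j = 0) ->
  fps2_sum u (fun i j => \sum_(n < (i + j).+1) (P n)`_i`_j).
Proof.
move=> uP P0; exists P => // i j; exists (i + j).+1 => M leM.
rewrite -(subnKC leM) big_split_ord /= [X in _ + X]big1 ?addr0 // => k _.
by apply: P0; rewrite /=; lia.
Qed.

Lemma eq_fps2_sum (u : nat -> ratfun R) S1 S2 :
  (forall i j, S1 i j = S2 i j) -> fps2_sum u S1 -> fps2_sum u S2.
Proof.
move=> eqS [P uP PS]; exists P => // i j.
by have [N PN] := PS i j; exists N => M /PN; rewrite eqS.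
Qed.

Lemma qpoch_infty_yt q :
  qpoch_infty q (yF R * tF R)
    (fun i j => eulery q (vary R) i%:Z * (j == 0)%:R).
Proof.
apply: eq_fps2_sum; last first.
  apply: (fps2_sum_order (P := fun k =>
    (eulery q (vary R) k%:Z)%:P%:P * 'X^k)) => [k|k i j ltk].
    exact: (morph_euler_t (polyF_morph R)).
  rewrite /= coefCM coefXn (_ : (i == k) = false) ?mulr0 ?coef0 //; lia.
move=> i j /=.
have coefE k : ((eulery q (vary R) k%:Z)%:P%:P * 'X^k : Cxyts R)`_i`_j
    = (if (k == i)%N then eulery q (vary R) i%:Z * (j == 0)%:R else 0).
  rewrite coefCM coefXn eq_sym; case: eqP => [->|_]; last by rewrite mulr0 coef0.
  by rewrite mulr1 coefC; case: eqP; rewrite ?mulr1 ?mulr0.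
have lti : (i < (i + j).+1)%N by lia.
under eq_bigr do rewrite coefE.
rewrite (bigD1 (Ordinal lti)) //= eqxx big1 ?addr0 // => k.
by rewrite -val_eqE /= => /negbTE->.
Qed.

Lemma qpoch_infty_ys q :
  qpoch_infty q (yF R * sF R)
    (fun i j => eulery q (vary R) j%:Z * (i == 0)%:R).
Proof.
apply: eq_fps2_sum; last first.
  apply: (fps2_sum_order (P := fun k =>
    ((eulery q (vary R) k%:Z)%:P * 'X^k)%:P)) => [k|k i j ltk].
    exact: (morph_euler_s (polyF_morph R)).
  rewrite /= coefC; case: eqP => i0; last by rewrite coef0.
  rewrite coefCM coefXn (_ : (j == k) = false) ?mulr0 ?coef0 //; lia.
move=> i j /=.
have coefE k : (((eulery q (vary R) k%:Z)%:P * 'X^k)%:P : Cxyts R)`_i`_j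
    = (if (k == j)%N then eulery q (vary R) j%:Z * (i == 0)%:R else 0).
  rewrite coefC [k == j]eq_sym; case: (i == 0); last first.
    by rewrite coef0 mulr0 if_same.
  by rewrite coefCM coefXn; case: eqP => [->|_]; rewrite ?mulr1 ?mulr0.
have ltj : (j < (i + j).+1)%N by lia.
under eq_bigr do rewrite coefE.
rewrite (bigD1 (Ordinal ltj)) //= eqxx big1 ?addr0 // => k.
by rewrite -val_eqE /= => /negbTE->.
Qed.

Lemma yt_neq0 : yF R * tF R != 0.
Proof.
apply: (tofrac_polyCX_neq0 (A := Cxy R)).
by rewrite -msize_poly_eq0 msizeX.
Qed.

Lemma polyF_summand q c n :
  cF c * (xF R * tF R) ^+ n
    * phi21 n (cF q ^- n) (cF q / (yF R * tF R)) 0 (cF q) (yF R * sF R)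
  = polyF (summand q (varx R) (vary R) c n).
Proof.
have := morph_summand (phi := polyF_morph R) (varx R) q c n yt_neq0.
exact.
Qed.

End Fractions.

Theorem theorem5 (R : realType) (q : R[i]) (r : nat)
    (a : 'I_r.+1 -> R[i]) (b : 'I_r -> R[i])
    (q_gt0 : 0 < `|q|) (q_lt1 : `|q| < 1)
    (b_neq0 : forall (j : 'I_r) (n : nat), qpoch (b j) q n != 0) :
  exists Et Es S : fps2 (Cxy R),
    [/\ qpoch_infty q (yF R * tF R) Et,
        qpoch_infty q (yF R * sF R) Es,
        fps2_sum
          (fun n =>
             cF (qpochs a q n / (qpoch q q n * qpochs b q n))
               * (xF R * tF R) ^+ n
               * phi21 n (cF q ^- n) (cF q / (yF R * tF R)) 0 (cF q)
                   (yF R * sF R))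
          S
      & forall n m : nat,
          ((-1) ^+ (n + m) * q ^+ ('C(n, 2) + 'C(m, 2))
             / (qpoch q q n * qpoch q q m))
            *: psi a b q (n + m) (varx R) (vary R)
          = fps2_mul (fps2_mul Et Es) S n m].
Proof.
have q_neq0 : q != 0 by rewrite -normr_gt0.
have q_not_unity n : q ^+ n.+1 != 1.
  apply/eqP => /(congr1 Num.norm) /eqP; rewrite normr1 normrX => /eqP q1.
  by have := exprn_ilt1 n.+1 (normr_ge0 q) q_lt1; rewrite q1 ltxx.
set c := fun n => qpochs a q n / (qpoch q q n * qpochs b q n).
pose P n := summand q (varx R) (vary R) (c n) n.
exists (fun i j => eulery q (vary R) i%:Z * (j == 0)%:R).
exists (fun i j => eulery q (vary R) j%:Z * (i == 0)%:R).
exists (fun i j => \sum_(n < (i + j).+1) (P n)`_i`_j); split.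
- exact: qpoch_infty_yt.
- exact: qpoch_infty_ys.
- apply: fps2_sum_order => [n|n i j]; first exact: polyF_summand.
  exact: coef_summand0.
move=> n m; rewrite {1}/fps2_mul.
transitivity (\sum_(N < (n + m).+1) \sum_(k < n.+1) \sum_(l < m.+1)
  eulery q (vary R) k%:Z * eulery q (vary R) l%:Z * (P N)`_(n - k)`_(m - l)).
  rewrite /psi scaler_sumr; apply: eq_bigr => N _.
  have leN : (N <= n + m)%N by rewrite -ltnS.
  rewrite mul_euler_summand // scalerA.
  have -> : absz ((n + m)%N%:Z - N%:Z) = (n + m - N)%N by lia.
  by congr (_ *: _); exact: psi_coef_match.
rewrite exchange_big; apply: eq_bigr => k _.
rewrite exchange_big; apply: eq_bigr => l _.
rewrite fps2_mul_prod mulr_sumr.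
(* [S] sums over N <= (n - k) + (m - l); the terms from there up to n + m vanish *)
have le_ij : ((n - k + (m - l)).+1 <= (n + m).+1)%N by lia.
rewrite -(subnKC le_ij) big_split_ord /= [X in _ + X]big1 ?addr0 // => i _.
by rewrite coef_summand0 ?mulr0 //; lia.
Qed.
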